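(* Let $I$ be a monomial ideal in $R=K[x_1,\ldots,x_n]$, let $<$ be a total order on $G(I)=\{m_1<m_2<\cdots<m_\mu\}$, and let $F=\{m_{i_1}<m_{i_2}<\cdots<m_{i_t}\}$ ($t\ge 1$) be a subset of $G(I)$. Then $F\in\Delta_{(I,<)}$ if and only if $u(i_1;i_2;\ldots;i_t)$ is an $L$-admissible symbol. In particular, $F$ is a facet of $\Delta_{(I,<)}$ if and only if $u(i_1;i_2;\ldots;i_t)$ is a maximal $L$-admissible symbol.
   Context: $K$ is a field and $G(I)$ denotes the minimal set of monomial generators of $I$, written $G(I)=\{m_1<\cdots<m_\mu\}$ in increasing order for the given total order $<$ (an arbitrary total order on the set $G(I)$). For $A\subseteq G(I)$, $\mathrm{lcm}(A)$ is the least common multiple of the elements of $A$. A symbol is $u(i_1;\ldots;i_t)$ with $1\le i_1<\cdots<i_t\le\mu$; it is $L$-admissible if for all $h<t$ and all $q<i_h$, $m_q$ does not divide $\mathrm{lcm}(m_{i_h},m_{i_{h+1}},\ldots,m_{i_t})$. Symbols are partially ordered by: $u(i_1;\ldots;i_s)\preceq u(j_1;\ldots;j_t)$ if $(i_1,\ldots,i_s)$ is a subsequence of $(j_1,\ldots,j_t)$; a maximal $L$-admissible symbol is one maximal among $L$-admissible symbols for this order. The Lyubeznik complex of $I$ under $<$ is the simplicial complex $\Delta_{(I,<)}=\{F\subseteq G(I) : \min\{u\in G(I): u\mid \mathrm{lcm}(H)\}\in H \text{ for all nonempty } H\subseteq F\}$, where the minimum is taken with respect to $<$. A facet is a face maximal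 under inclusion. *)

(* Defs.v *)
From HB Require Import structures.
From mathcomp Require Import all_boot all_order all_algebra.
From mathcomp Require Import finmap.
From mathcomp Require Import mpoly.

Set Implicit Arguments.
Unset Strict Implicit.
Unset Printing Implicit Defensive.

Import GRing.Theory.

Local Open Scope fset_scope.
Local Open Scope ring_scope.

(* A monomial of K[x_1, ..., x_n] is represented by its exponent vector in
   'X_{1..n}; (a <= b)%MM is the componentwise order on exponents, that is,
   divisibility of monomials. *)

Section MonomialIdeals.
Variables (K : fieldType) (n : nat).
Implicit Types (I : {mpoly K[n]} -> Prop) (G : {fset 'X_{1..n}}).

Definition in_monomial_span (S : 'X_{1..n} -> Prop) (p : {mpoly K[n]}) : Prop :=
  exists2 r : seq ({mpoly K[n]} * 'X_{1..n}),
    forall c, c \in r -> S c.2 & p = \sum_(c <- r) c.1 * 'X_[c.2].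

Definition generated_by I (S : 'X_{1..n} -> Prop) : Prop :=
  forall p, I p <-> in_monomial_span S p.

Definition monomial_ideal I : Prop :=
  exists S : 'X_{1..n} -> Prop, generated_by I S.

Definition minimal_monomial_generators I G : Prop :=
  generated_by I (fun a => a \in G) /\
  forall G' : {fset 'X_{1..n}},
    G' `<=` G -> generated_by I (fun a => a \in G') -> G' = G.

End MonomialIdeals.

Section LyubeznikComplex.
Variables (n : nat) (G : {fset 'X_{1..n}}) (lt : rel 'X_{1..n}).
Implicit Types (A F H : {fset 'X_{1..n}}) (a b : 'X_{1..n}).

Definition strict_total_order_on : Prop :=
  [/\ {in G, irreflexive lt}, {in G & &, transitive lt} &
      {in G &, forall a b, a != b -> lt a b || lt b a}].

Definition is_min A a : Prop :=
  a \in A /\ forall b, b \in A -> b != a -> lt a b.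

Definition lcm_of A : 'X_{1..n} := \big[@mlcm n/0%MM]_(a <- A) a.

Definition lyubeznik_complex F : Prop :=
  F `<=` G /\
  forall H, H `<=` F -> H != fset0 ->
    exists2 a, is_min [fset b in G | (b <= lcm_of H)%MM] a & a \in H.

Definition lyubeznik_facet F : Prop :=
  lyubeznik_complex F /\
  forall F', lyubeznik_complex F' -> F `<=` F' -> F' = F.

End LyubeznikComplex.

(* The generators are m 0, ..., m (mu - 1), so that the symbol
   u(i_1; ...; i_t) with t >= 1 is the sequence [:: i_1 - 1; ...; i_t - 1]. *)
Section Symbols.
Variables (n mu : nat) (m : 'I_mu -> 'X_{1..n}).
Implicit Types s : seq 'I_mu.

Definition is_symbol s : bool :=
  (s != [::]) && sorted (fun i j : 'I_mu => i < j)%N s.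

(* The condition bears on every position except the last one. *)
Definition L_admissible s : Prop :=
  is_symbol s /\
  forall h : 'I_(size s), (h.+1 < size s)%N ->
  forall q : 'I_mu, (q < tnth (in_tuple s) h)%N ->
    ~~ (m q <= \big[@mlcm n/0%MM]_(i <- drop h s) m i)%MM.

Definition maximal_L_admissible s : Prop :=
  L_admissible s /\
  forall s', L_admissible s' -> subseq s s' -> s' = s.

End Symbols.

(* Main.v *)
Require Import Defs.
From mathcomp Require Import all_boot all_order all_algebra.
From mathcomp Require Import finmap.
From mathcomp Require Import mpoly.

(** Since [m] is increasing, it identifies symbols with nonempty subsets of
    [G], and the elements of [G] below [m i] are the [m q] with [q < i].

    If the minimum of the divisors of [lcm H] lies in [H] for every [H], apply
    this to the tail [H = {m_(i_h), ..., m_(i_t)}]: a generator [m_q] with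
    [q < i_h] would be a divisor below every element of [H], hence below the
    minimum.  Conversely, let [H] be a nonempty subset of [F] and [m_(i_h)] its
    smallest element.  Then [lcm H] divides the lcm of the tail of the symbol
    from position [h], so admissibility says that no generator below [m_(i_h)]
    divides [lcm H], and [m_(i_h)] is the required minimum.  Admissibility is
    silent about the last position [h = t]; there [H = {m_(i_t)}], and the
    minimality of the generating set takes over: distinct minimal generators do
    not divide each other ([minimal_generators_antichain]).  These are
    [complex_admissible] and [admissible_complex].

    The statement on facets follows because inclusion of faces corresponds to
    the subsequence order on symbols ([symbol_subseq]) and every nonempty subset
    of [G] comes from a symbol ([symbol_of_fset]). *)

Local Open Scope fset_scope.
Local Open Scope ring_scope.

(** * Least common multiples of monomials *)

Lemma lcm_le (n : nat) (J : Type) (r : seq J) (f : J -> 'X_{1..n}) c :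
  (\big[@mlcm n/0%MM]_(i <- r) f i <= c)%MM = all (fun i => f i <= c)%MM r.
Proof.
elim: r => [|i r IHr] /=; last by rewrite big_cons lem_mlcm IHr.
by rewrite big_nil; apply/mnm_lepP => k; rewrite mnm0E.
Qed.

Lemma le_lcm (n : nat) (J : eqType) (r : seq J) (f : J -> 'X_{1..n}) i :
  i \in r -> (f i <= \big[@mlcm n/0%MM]_(j <- r) f j)%MM.
Proof.
have := lepm_refl (\big[@mlcm n/0%MM]_(j <- r) f j); rewrite {1}lcm_le.
by move=> /allP; apply.
Qed.

(** * Minimal monomial generators *)

(** A generator [b] that is a proper multiple of a generator [a] is redundant:
    in a combination, [p * b] can be rewritten as [(p * (b / a)) * a]. *)
Lemma minimal_generators_antichain (K : fieldType) (n : nat)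
    (I : {mpoly K[n]} -> Prop) (G : {fset 'X_{1..n}}) a b :
  minimal_monomial_generators I G -> a \in G -> b \in G -> (a <= b)%MM -> a = b.
Proof.
move=> [genG minG] aG bG leab; apply/eqP/negPn/negP => neab.
suff genGb : generated_by I (fun c => c \in G `\ b).
  by have := bG; rewrite -(minG _ (fsubD1set G b) genGb) !inE eqxx.
move=> p; rewrite genG; split=> -[r rS ->]; last first.
  by exists r => // c /rS; rewrite !inE => /andP[].
pose g (c : {mpoly K[n]} * 'X_{1..n}) :=
  if c.2 == b then (c.1 * 'X_[b - a], a) else c.
exists (map g r).
  move=> _ /mapP[c /rS cG ->]; rewrite /g; case: eqP => [_|/eqP cb] /=.
    by rewrite !inE neab.
  by rewrite !inE cb.
rewrite big_map; apply: eq_bigr => c _; rewrite /g; case: eqP => //= ->.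
by rewrite -GRing.mulrA -mpolyXD submK.
Qed.

(** * Symbols *)

Lemma ord_ltn_trans (mu : nat) : transitive (fun i j : 'I_mu => i < j)%N.
Proof. by move=> j i k; apply: ltn_trans. Qed.

Lemma ord_ltn_irr (mu : nat) : irreflexive (fun i j : 'I_mu => i < j)%N.
Proof. by move=> i; apply: ltnn. Qed.

Lemma symbol_tail_ge (mu : nat) (s : seq 'I_mu) (x0 : 'I_mu) h j :
  is_symbol s -> (h < size s)%N -> j \in drop h s -> (nth x0 s h <= j)%N.
Proof.
move=> /andP[_ /(drop_sorted h)]; move=> + hs; rewrite (drop_nth x0 hs) /=.
move=> /(order_path_min (@ord_ltn_trans mu)) /allP s_gt.
by rewrite inE => /predU1P[-> //|/s_gt /ltnW].
Qed.

Lemma symbol_mem_tail (mu : nat) (s : seq 'I_mu) i j :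
  is_symbol s -> i \in s -> j \in s -> (i <= j)%N -> j \in drop (index i s) s.
Proof.
move=> /andP[_ s_sorted] si sj leij.
have := sj; rewrite -{1}(cat_take_drop (index i s) s) mem_cat in_take //.
case/orP => // /(sorted_ltn_index (@ord_ltn_trans mu) s_sorted).
by move=> /(_ sj si); rewrite ltnNge leij.
Qed.

Lemma symbol_eq (mu : nat) (s s' : seq 'I_mu) :
  is_symbol s -> is_symbol s' -> s =i s' -> s = s'.
Proof.
move=> /andP[_ ss] /andP[_ ss'].
exact: irr_sorted_eq (@ord_ltn_trans mu) (@ord_ltn_irr mu) _ _ ss ss'.
Qed.

(** An increasing sequence is determined by its entries, so [s] is [s'] filtered
    by membership in [s]. *)
Lemma symbol_subseq (mu : nat) (s s' : seq 'I_mu) :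
  is_symbol s -> is_symbol s' -> {subset s <= s'} -> subseq s s'.
Proof.
move=> /andP[_ ss] /andP[_ ss'] sub.
suff -> : s = [seq i <- s' | i \in s] by apply: filter_subseq.
apply: irr_sorted_eq (@ord_ltn_trans mu) (@ord_ltn_irr mu) _ _ ss _ _.
  exact: sorted_filter (@ord_ltn_trans mu) _ _ ss'.
by move=> i; rewrite mem_filter; case: (boolP (i \in s)) => // /sub ->.
Qed.

Lemma symbol_of_fset (n mu : nat) (m : 'I_mu -> 'X_{1..n})
    (F : {fset 'X_{1..n}}) :
  F `<=` [fset m i | i in 'I_mu] -> F != fset0 ->
  exists2 s, is_symbol s & F = [fset m i | i in s].
Proof.
move=> /fsubsetP subF /fset0Pn[a aF].
exists [seq i <- enum 'I_mu | m i \in F].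
  apply/andP; split.
    have /imfsetP[i _ def_a] := subF _ aF.
    apply/eqP => s0; have: i \in [seq i <- enum 'I_mu | m i \in F].
      by rewrite mem_filter -def_a aF mem_enum.
    by rewrite s0.
  apply: sorted_filter (@ord_ltn_trans mu) _ _ _.
  by rewrite -(sorted_map (f := val) (e' := ltn)) val_enum_ord iota_ltn_sorted.
apply/fsetP => b; apply/idP/imfsetP => [bF|[i /= + ->]].
  have /imfsetP[i _ def_b] := subF _ bF.
  by exists i; rewrite //= mem_filter -def_b bF mem_enum.
by rewrite mem_filter => /andP[].
Qed.

(** * Faces and admissible symbols *)

Lemma enumeration_inj (n mu : nat) (G : {fset 'X_{1..n}})
    (lt : rel 'X_{1..n}) (m : 'I_mu -> 'X_{1..n}) :
  strict_total_order_on G lt -> (forall i, m i \in G) ->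
  (forall i j : 'I_mu, (i < j)%N -> lt (m i) (m j)) -> injective m.
Proof.
move=> [irr _ _] mG lt_m i j mij.
have [/lt_m|/lt_m|/val_inj //] := ltngtP i j.
  by rewrite mij irr.
by rewrite mij irr.
Qed.

(** A generator [m q] breaking admissibility at position [h] divides the lcm of
    the tail from [h], so the minimal divisor of that lcm is at most [m q]; but
    being in the tail it lies above [m q]. *)
Lemma complex_admissible (n mu : nat) (G : {fset 'X_{1..n}})
    (lt : rel 'X_{1..n}) (m : 'I_mu -> 'X_{1..n}) (s : seq 'I_mu) :
  strict_total_order_on G lt -> (forall i, m i \in G) ->
  (forall i j : 'I_mu, (i < j)%N -> lt (m i) (m j)) -> is_symbol s ->
  lyubeznik_complex G lt [fset m i | i in s] -> L_admissible m s.
Proof.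
move=> [irr tr _] mG lt_m sym [_ minF]; split=> // h _ q.
rewrite (tnth_nth q) /= => q_lt; apply/negP => q_dvd.
have hs := ltn_ord h; pose H := [fset m i | i in drop h s].
have HF : H `<=` [fset m i | i in s].
  by apply/fsubsetP => _ /imfsetP[i /= /mem_drop si ->]; apply: in_imfset.
have H0 : H != fset0.
  apply/fset0Pn; exists (m (nth q s h)); apply: in_imfset => /=.
  by rewrite (drop_nth q hs) mem_head.
have [a [_ min_a] /imfsetP[j /= j_tail def_a]] := minF H HF H0.
rewrite def_a in min_a.
have lt_qj : lt (m q) (m j).
  by apply/lt_m/(leq_trans q_lt)/symbol_tail_ge.
have lt_jq : lt (m j) (m q).
  apply: min_a; last by apply: contraTneq lt_qj => ->; rewrite irr.
  rewrite !inE mG /=; apply: lepm_trans q_dvd _; rewrite lcm_le.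
  by apply/allP => i i_tail; apply: (le_lcm _ _ _ id); apply: in_imfset.
by have := tr _ _ _ (mG j) (mG q) (mG q) lt_qj lt_jq; rewrite irr.
Qed.

(** The minimal divisor of [lcm H] is the smallest element [m i] of [H]:
    admissibility at the position of [i] excludes every smaller generator, since
    [H] is contained in the tail of the symbol starting at [i]. *)
Lemma admissible_complex (n mu : nat) (G : {fset 'X_{1..n}})
    (lt : rel 'X_{1..n}) (m : 'I_mu -> 'X_{1..n}) (s : seq 'I_mu) :
  {in G &, forall a b, (a <= b)%MM -> a = b} ->
  strict_total_order_on G lt -> G = [fset m i | i in 'I_mu] ->
  (forall i j : 'I_mu, (i < j)%N -> lt (m i) (m j)) ->
  L_admissible m s -> lyubeznik_complex G lt [fset m i | i in s].
Proof.
move=> antichain ord defG lt_m [sym adm].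
have mG i : m i \in G by rewrite defG; apply: in_imfset.
have m_inj := enumeration_inj _ _ _ _ _ ord mG lt_m.
split; first by apply/fsubsetP => _ /imfsetP[i _ ->].
move=> H /fsubsetP HF /fset0Pn[a0 a0H].
have /imfsetP[i0 _ def_a0] := HF _ a0H; rewrite def_a0 in a0H.
case: (@arg_minnP _ i0 (fun i => m i \in H) val a0H) => i iH i_min.
have s_of j : m j \in H -> j \in s.
  by move=> /HF /imfsetP[k /= sk /m_inj ->].
have H_tail j : m j \in H -> j \in drop (index i s) s.
  by move=> jH; rewrite symbol_mem_tail ?s_of ?i_min.
have si := s_of _ iH; have his : (index i s < size s)%N by rewrite index_mem.
have lcmH_dvd : (lcm_of H <= \big[@mlcm n/0%MM]_(j <- drop (index i s) s) m j)%MM.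
  rewrite /lcm_of lcm_le; apply/allP => b bH.
  have /imfsetP[j _ def_b] := HF _ bH; rewrite def_b in bH *.
  by apply: le_lcm; apply: H_tail.
exists (m i) => //; split; first by rewrite !inE mG /=; apply: (le_lcm _ _ _ id).
move=> b; rewrite !inE => /andP[/[dup] bG].
rewrite {1}defG => /imfsetP[q _ def_b]; rewrite def_b in bG * => q_dvd neqi.
case: (ltngtP i q) => [/lt_m //|q_lt|/val_inj iq]; last by rewrite iq eqxx in neqi.
have q_dvd_tail := lepm_trans q_dvd lcmH_dvd.
have [h_last|h_last] := ltnP (index i s).+1 (size s).
  have /= := adm (Ordinal his) h_last q.
  by rewrite (tnth_nth i) /= nth_index // q_dvd_tail => /(_ q_lt).
(* Admissibility says nothing about the last position, but the tail there is the
   single generator m i, which no other generator divides. *)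
move: q_dvd_tail; rewrite (drop_nth i his) nth_index // (drop_oversize h_last).
rewrite big_cons big_nil mlcm0 => /(antichain _ _ bG (mG i)) eq_qi.
by rewrite eq_qi eqxx in neqi.
Qed.

Theorem theorem3p2 (K : fieldType) (n : nat) (I : {mpoly K[n]} -> Prop)
    (G : {fset 'X_{1..n}}) (lt : rel 'X_{1..n})
    (mu : nat) (m : 'I_mu -> 'X_{1..n})
    (F : {fset 'X_{1..n}}) (s : seq 'I_mu) :
  monomial_ideal I ->
  minimal_monomial_generators I G ->
  strict_total_order_on G lt ->
  G = [fset m i | i in 'I_mu] ->
  (forall i j : 'I_mu, (i < j)%N -> lt (m i) (m j)) ->
  is_symbol s ->
  F = [fset m i | i in s] ->
  (lyubeznik_complex G lt F <-> L_admissible m s) /\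
  (lyubeznik_facet G lt F <-> maximal_L_admissible m s).
Proof.
move=> _ minG ord defG lt_m sym ->.
have mG i : m i \in G by rewrite defG; apply: in_imfset.
have m_inj := enumeration_inj _ _ _ _ _ ord mG lt_m.
have face_iff t : is_symbol t ->
    lyubeznik_complex G lt [fset m i | i in t] <-> L_admissible m t.
  move=> symt; split; first exact: complex_admissible.
  apply: admissible_complex => // a b aG bG.
  exact: (minimal_generators_antichain K n I G) minG aG bG.
have mem_m t i : (m i \in [fset m j | j in t]) = (i \in (t : seq 'I_mu)).
  by apply/imfsetP/idP => [[j /= tj /m_inj ->]|ti] //; exists i.
split; first exact: face_iff.
split=> [[Fface Fmax]|[adm s_max]].
  split; first exact/face_iff.
  move=> t admt /mem_subseq sub_st; have [symt _] := admt.
  have eqF : [fset m i | i in t] = [fset m i | i in s].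
    apply: Fmax; first exact/face_iff.
    by apply/fsubsetP => _ /imfsetP[i /= /sub_st ti ->]; rewrite mem_m.
  by apply: symbol_eq => // i; rewrite -!mem_m eqF.
split; first exact/face_iff.
move=> F' face' sub_F.
have F'0 : F' != fset0.
  have [i si] : exists i, i \in s.
    by case: (s) sym => // i s' _; exists i; apply: mem_head.
  by apply/fset0Pn; exists (m i); rewrite (fsubsetP sub_F) // mem_m.
have [t symt defF'] : exists2 t, is_symbol t & F' = [fset m i | i in t].
  by apply: symbol_of_fset => //; case: face'; rewrite defG.
rewrite defF' in face' sub_F *; rewrite (s_max t) //; first exact/face_iff.
apply: symbol_subseq => // i si.
by rewrite -mem_m (fsubsetP sub_F) // mem_m.
Qed.
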